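(* Let $n$ be a nonzero integer and $a,b$ positive integers with $n>0$ or $ab$ odd. If $\mathfrak X(\mathbb{Z}_v)\neq\emptyset$ for every place $v$ of $\mathbb{Q}$ and $|I_w|=2$ for some place $w$, then strong approximation ''at $Z$'' away from $\infty$ fails for $x^2+y^2+z^{ab}=n^a$ due to a Brauer--Manin obstruction: there is a point of $\mathfrak X(\mathbb{A}_{\{\infty\}})$ not lying in $\mathfrak X(\mathbb{A}_{\{\infty\}})^A$, hence not in the closure of $\mathfrak X(\mathbb{Q})$.
   Context: $\mathfrak X=\operatorname{Spec}\mathbb{Z}[X,Y,Z]/(X^2+Y^2+Z^{ab}-n^a)$; $\mathfrak X(R)$ is the set of solutions in $R^3$. Places $v$ are primes and $\infty$; $\mathbb{Z}_\infty=\mathbb{Q}_\infty=\mathbb{R}$. For $u\in\mathbb{Q}_v^\times$, $(u,-1)_v=1$ if $u$ is a sum of two squares in $\mathbb{Q}_v$, else $-1$. Let $g(Z)=\sum_{i=0}^{a-1}n^{a-1-i}Z^{ib}$, so $n^a-Z^{ab}=(n-Z^b)g(Z)$. $A$ is the Azumaya algebra on $\mathfrak X_\mathbb{Q}$ given by the quaternion algebra $(n-Z^b,-1)$ on $D(n-Z^b)$ and $(g(Z),-1)$ on $D(g(Z))$, glued via $i\mapsto(Xi'+Yi'j')/g(Z)$, $j\mapsto j'$. For $P=(x,y,z)\in\mathfrak X(\mathbb{Q}_v)$, $\operatorname{inv}_vA(P)\in\{0,1/2\}\subset\mathbb{Q}/\mathbb{Z}$ is $0$ iff $(n-z^b,-1)_v=1$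 when $n\neq z^b$, and $0$ iff $(g(z),-1)_v=1$ when $g(z)\neq0$. $I_v=\{\operatorname{inv}_vA(P)\mid P\in\mathfrak X(\mathbb{Z}_v)\}$. Topology ''at $Z$'': on $\mathbb{Q}_v^3$ the indiscrete topology on the first two coordinates times the usual topology on the third; $\mathfrak X(\mathbb{A}_{\{\infty\}})$ (families $(P_p)_p$ over primes with $P_p\in\mathfrak X(\mathbb{Q}_p)$, $P_p\in\mathfrak X(\mathbb{Z}_p)$ for almost all $p$) carries the induced restricted product topology, $\mathfrak X(\mathbb{Q})$ embedded diagonally. Strong approximation at $Z$ away from $\infty$ means $\mathfrak X(\mathbb{Q})$ dense in $\mathfrak X(\mathbb{A}_{\{\infty\}})$. $\mathfrak X(\mathbb{A}_{\{\infty\}})^A$ is the set of $(P_p)_p$ for which some $P_\infty\in\mathfrak X(\mathbb{R})$ gives $\sum_v\operatorname{inv}_vA(P_v)=0$; it contains the closure of $\mathfrak X(\mathbb{Q})$. *)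

(* Defs.v *)
From HB Require Import structures.
From mathcomp Require Import all_boot all_order all_algebra.
From mathcomp Require Import all_classical all_reals all_analysis.
From mathcomp Require Import ring.

Set Implicit Arguments.
Unset Strict Implicit.
Unset Printing Implicit Defensive.

Import Order.TTheory GRing.Theory Num.Theory.

Local Open Scope classical_set_scope.
Local Open Scope quotient_scope.
Local Open Scope ring_scope.

Definition prime_nat : Type := {p : nat | prime p}.

(* The p-adic integers, as the inverse limit of the rings Z/p^k: the class    *)
(* modulo p^k is given by its representative padic_res k in [0, p^k[.         *)
Record padic_int (p : prime_nat) := PadicInt {
  padic_res : nat -> int;
  padic_resP : forall k,
    padic_res k = (padic_res k.+1 %% (val p ^ k)%N%:Z)%Z }.

HB.instance Definition _ p := gen_eqMixin (padic_int p).
HB.instance Definition _ p := gen_choiceMixin (padic_int p).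

Section PadicIntRing.
Variable p : prime_nat.
Local Notation q k := ((val p ^ k)%N%:Z).
Implicit Types x y z : padic_int p.

Lemma padic_int_eq x y : padic_res x =1 padic_res y -> x = y.
Proof.
case: x y => [f fP] [g gP] /= /funext fg; subst g.
by rewrite (Prop_irrelevance fP gP).
Qed.

Lemma padic_pow_neq0 k : q k != 0.
Proof. by rewrite eqz_nat -lt0n expn_gt0 prime_gt0 // (valP p). Qed.

Lemma padic_res_mod x k : (padic_res x k %% q k)%Z = padic_res x k.
Proof. by rewrite padic_resP modz_mod. Qed.

Lemma padic_modS m k : ((m %% q k.+1)%Z = m %[mod q k])%Z.
Proof.
apply/eqP; rewrite eqz_mod_dvd {2}(divz_eq m (q k.+1)) opprD addrCA subrr addr0.
by rewrite rpredN; apply: dvdz_mull; rewrite expnSr PoszM dvdz_mulr.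
Qed.

Lemma padic_int_subproof (h : nat -> int) :
  (forall k, h k.+1 = h k %[mod q k])%Z ->
  forall k, (h k %% q k)%Z = ((h k.+1 %% q k.+1)%Z %% q k)%Z.
Proof. by move=> hP k; rewrite padic_modS hP. Qed.

Definition padic_mk (h : nat -> int)
    (hP : forall k, (h k.+1 = h k %[mod q k])%Z) : padic_int p :=
  PadicInt (padic_int_subproof hP).

Lemma padic_res_congr x k :
  (padic_res x k.+1 = padic_res x k %[mod q k])%Z.
Proof. by rewrite [in RHS]padic_resP modz_mod. Qed.

Lemma padic_cst_subproof (m : int) : forall k : nat, (m = m %[mod q k])%Z.
Proof. by []. Qed.

Lemma padic_opp_subproof x k :
  (- padic_res x k.+1 = - padic_res x k %[mod q k])%Z.
Proof. by rewrite -modzNm padic_res_congr modzNm. Qed.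

Lemma padic_add_subproof x y k :
  (padic_res x k.+1 + padic_res y k.+1
    = padic_res x k + padic_res y k %[mod q k])%Z.
Proof. by rewrite -modzDm !padic_res_congr modzDm. Qed.

Lemma padic_mul_subproof x y k :
  (padic_res x k.+1 * padic_res y k.+1
    = padic_res x k * padic_res y k %[mod q k])%Z.
Proof. by rewrite -modzMm !padic_res_congr modzMm. Qed.

Definition padic_cst m := padic_mk (padic_cst_subproof m).
Definition padic_opp x := padic_mk (padic_opp_subproof x).
Definition padic_add x y := padic_mk (padic_add_subproof x y).
Definition padic_mul x y := padic_mk (padic_mul_subproof x y).

Lemma padic_addA : associative padic_add.
Proof.
by move=> x y z; apply: padic_int_eq => k /=; rewrite modzDmr modzDml addrA.
Qed.

Lemma padic_addC : commutative padic_add.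
Proof. by move=> x y; apply: padic_int_eq => k /=; rewrite addrC. Qed.

Lemma padic_add0 : left_id (padic_cst 0) padic_add.
Proof.
by move=> x; apply: padic_int_eq => k /=; rewrite modzDml add0r padic_res_mod.
Qed.

Lemma padic_addN : left_inverse (padic_cst 0) padic_opp padic_add.
Proof.
by move=> x; apply: padic_int_eq => k /=; rewrite modzDml addNr.
Qed.

HB.instance Definition _ :=
  GRing.isZmodule.Build (padic_int p) padic_addA padic_addC padic_add0 padic_addN.

Lemma padic_mulA : associative padic_mul.
Proof.
by move=> x y z; apply: padic_int_eq => k /=; rewrite modzMmr modzMml mulrA.
Qed.

Lemma padic_mulC : commutative padic_mul.
Proof. by move=> x y; apply: padic_int_eq => k /=; rewrite mulrC. Qed.

Lemma padic_mul1 : left_id (padic_cst 1) padic_mul.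
Proof.
by move=> x; apply: padic_int_eq => k /=; rewrite modzMml mul1r padic_res_mod.
Qed.

Lemma padic_mulDl : left_distributive padic_mul padic_add.
Proof.
move=> x y z; apply: padic_int_eq => k /=.
by rewrite modzMml modzDm mulrDl.
Qed.

Lemma padic_one_neq0 : padic_cst 1 != 0.
Proof.
apply/eqP => /(congr1 (fun x => padic_res x 1%N)) /= /eqP.
have p_gt1 := prime_gt1 (valP p).
by rewrite expn1 !modz_small //= ?ltz_nat ?(ltnW p_gt1).
Qed.

HB.instance Definition _ := GRing.Zmodule_isComNzRing.Build (padic_int p)
  padic_mulA padic_mulC padic_mul1 padic_mulDl padic_one_neq0.

Definition padic_unit : pred (padic_int p) :=
  fun x => `[< exists y, y * x = 1 >].
Definition padic_inv x :=
  if pselect (exists y, y * x = 1) is left ex then projT1 (cid ex) else x.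

Lemma padic_mulVr : {in padic_unit, left_inverse 1 padic_inv *%R}.
Proof.
move=> x /asboolP ex; rewrite /padic_inv.
by case: pselect => // ex'; case: cid.
Qed.

Lemma padic_unitP x y : y * x = 1 -> padic_unit x.
Proof. by move=> yx; apply/asboolP; exists y. Qed.

Lemma padic_inv_out : {in [predC padic_unit], padic_inv =1 id}.
Proof.
move=> x /asboolPn nex; rewrite /padic_inv.
by case: pselect => // ex; case: nex.
Qed.

HB.instance Definition _ := GRing.ComNzRing_hasMulInverse.Build (padic_int p)
  padic_mulVr padic_unitP padic_inv_out.

Lemma padic_res_congrD x k l :
  (padic_res x (k + l) = padic_res x k %[mod q k])%Z.
Proof.
elim: l => [|l IHl]; first by rewrite addn0.
rewrite addnS -IHl; apply/eqP; rewrite eqz_mod_dvd.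
apply: (@dvdz_trans (q (k + l))); first by rewrite expnD PoszM dvdz_mulr.
by rewrite -eqz_mod_dvd; apply/eqP/padic_res_congr.
Qed.

Lemma padic_res_neq0 x : x != 0 ->
  exists k, forall l, ~~ (q k %| padic_res x (k + l))%Z.
Proof.
move=> x0; have [k xk] : exists k, padic_res x k != 0.
  apply: contrapT => nex; case/eqP: x0; apply: padic_int_eq => k.
  rewrite /= mod0z; apply: contrapT => /eqP xk.
  by apply: nex; exists k.
exists k => l; apply: contra xk => /dvdz_mod0P.
by rewrite padic_res_congrD padic_res_mod => ->.
Qed.

Lemma primepow_dvdM (u v : int) k l :
  (q (k + l) %| u * v)%Z -> (q k %| u)%Z || (q l %| v)%Z.
Proof.
have pp := valP p; rewrite !dvdzE abszM !absz_nat /=.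
have [->|u0] := posnP `|u|%N; first by rewrite dvdn0.
have [->|v0] := posnP `|v|%N; first by rewrite dvdn0 orbT.
rewrite !pfactor_dvdn ?muln_gt0 ?u0 ?v0 // lognM //.
case: (leqP k) => //= uk kluv.
by rewrite -(leq_add2l k) (leq_trans kluv) // leq_add2r ltnW.
Qed.

Lemma padic_int_domain : GRing.integral_domain_axiom (padic_int p).
Proof.
move=> x y xy0; apply: contrapT => /negP; rewrite negb_or => /andP[x0 y0].
have [k xk] := padic_res_neq0 x0; have [l yl] := padic_res_neq0 y0.
have: (q (k + l) %| padic_res x (k + l) * padic_res y (l + k))%Z.
  apply/dvdz_mod0P; move: (congr1 (fun z => padic_res z (k + l)) xy0) => /=.
  by rewrite mod0z [(l + k)%N]addnC.
by move=> /primepow_dvdM; rewrite (negPf (xk _)) (negPf (yl _)).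
Qed.

HB.instance Definition _ :=
  GRing.ComUnitRing_isIntegral.Build (padic_int p) padic_int_domain.

End PadicIntRing.

Definition padic_num (p : prime_nat) : Type := {fraction padic_int p}.

HB.instance Definition _ p := GRing.Field.on (padic_num p).

(* The image of Z_p in Q_p. *)
Definition padic_integral (p : prime_nat) : set (padic_num p) :=
  range (@tofrac (padic_int p)).

Section PadicTopology.
Variable p : prime_nat.
Local Notation Qp := (padic_num p).

(* The sets x + p^k Z_p form a basis of neighbourhoods of x. *)
Definition padic_open (U : set Qp) : Prop :=
  forall x, U x -> exists k : nat, forall t : Qp,
    padic_integral t -> U (x + (val p)%:R ^+ k * t).

Lemma padic_openT : padic_open setT.
Proof. by move=> x _; exists 0%N. Qed.

Lemma padic_openI : setI_closed padic_open.
Proof.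
have sub k l t : padic_integral t -> padic_integral (((val p)%:R : Qp) ^+ l * t)
    /\ ((val p)%:R : Qp) ^+ (k + l) * t = (val p)%:R ^+ k * ((val p)%:R ^+ l * t).
  move=> [z _ <-]; rewrite exprD mulrA; split=> //.
  by exists ((val p)%:R ^+ l * z) => //; rewrite rmorphM rmorphXn rmorph_nat.
move=> A B Ao Bo x [/Ao[k Ak] /Bo[l Bl]]; exists (k + l)%N => t tZ; split.
  by have [? ->] := sub k l t tZ; apply: Ak.
by rewrite addnC; have [? ->] := sub l k t tZ; apply: Bl.
Qed.

Lemma padic_open_bigU (I : Type) (f : I -> set Qp) :
  (forall i, padic_open (f i)) -> padic_open (\bigcup_i f i).
Proof.
move=> fo x [i _ /fo[k fk]]; exists k => t tZ.
by exists i => //; apply: fk.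
Qed.

HB.instance Definition _ :=
  isOpenTopological.Build Qp padic_openT padic_openI padic_open_bigU.

End PadicTopology.

Definition indiscrete (T : Type) : Type := T.

Section Indiscrete.
Variable T : choiceType.

HB.instance Definition _ := Choice.on (indiscrete T).

Definition indiscrete_open : set_system (indiscrete T) := [set set0; setT].

Lemma indiscrete_openT : indiscrete_open setT.
Proof. by right. Qed.

Lemma indiscrete_openI : setI_closed indiscrete_open.
Proof.
by move=> A B [->|->] [->|->]; rewrite ?set0I ?setI0 ?setIT; [left..|right].
Qed.

Lemma indiscrete_open_bigU (I : Type) (f : I -> set (indiscrete T)) :
  (forall i, indiscrete_open (f i)) -> indiscrete_open (\bigcup_i f i).
Proof.
move=> fo; have [[i fiT]|nfT] := pselect (exists i, f i = setT).
  by right; apply/seteqP; split=> // x _; exists i => //; rewrite fiT.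
left; apply/seteqP; split=> // x [i _]; case: (fo i) => [->//|fiT].
by case: nfT; exists i.
Qed.

HB.instance Definition _ := isOpenTopological.Build (indiscrete T)
  indiscrete_openT indiscrete_openI indiscrete_open_bigU.

End Indiscrete.

Section RatPadic.

Lemma padic_cst_int (p : prime_nat) (m : int) : padic_cst p m = m%:~R.
Proof.
have cstD (u v : int) : padic_cst p (u + v) = padic_cst p u + padic_cst p v.
  by apply: padic_int_eq => k /=; rewrite modzDm.
have cst_nat (k : nat) : padic_cst p k%:Z = k%:R.
  by elim: k => // k IHk; rewrite -addn1 PoszD cstD IHk natrD.
case: m => k; first by rewrite cst_nat.
rewrite NegzE mulrNz -[_%:~R]cst_nat; apply/eqP.
by rewrite -addr_eq0 -cstD addNr.
Qed.

Lemma padic_int_coprime_unit (p : prime_nat) (d : int) :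
  coprimez d (val p)%:Z -> exists x : padic_int p, x * d%:~R = 1.
Proof.
move=> dp; pose h k := (egcdz d (val p ^ k)%N%:Z).1.
have hP k : (h k * d = 1 %[mod (val p ^ k)%N%:Z])%Z.
  rewrite /h; case: egcdzP => u v Euv _ /=.
  have: gcdz d (val p ^ k)%N%:Z = 1.
    by apply/eqP; rewrite -[_ == _]/(coprimez _ _) -natz natrX coprimezXr // natz.
  by rewrite -Euv => <-; rewrite addrC modzMDl.
have hS k : (h k.+1 = h k %[mod (val p ^ k)%N%:Z])%Z.
  have h1 : (h k.+1 * d = 1 %[mod (val p ^ k)%N%:Z])%Z.
    by rewrite -padic_modS hP padic_modS.
  rewrite -[h k.+1]mulr1 -modzMmr -(hP k) modzMmr mulrCA -modzMmr h1 modzMmr.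
  by rewrite mulr1.
exists (padic_mk hS); rewrite -padic_cst_int; apply: padic_int_eq => k /=.
by rewrite modzMm hP.
Qed.

Lemma padic_num_char0 (p : prime_nat) (m : int) :
  m != 0 -> m%:~R != 0 :> padic_num p.
Proof.
move=> m0; rewrite -(rmorph_int (@tofrac (padic_int p))) tofrac_eq0.
rewrite -padic_cst_int; apply/eqP => /(congr1 (fun x => padic_res x `|m|%N)) /=.
rewrite mod0z => /dvdz_mod0P; rewrite dvdzE absz_nat => /dvdn_leq.
by rewrite absz_gt0 m0 leqNgt ltn_expl ?prime_gt1 ?(valP p) // => /(_ isT).
Qed.

Lemma padic_ratr_eq (p : prime_nat) (r : rat) (u v : int) :
  v != 0 -> r * v%:~R = u%:~R -> ratr r = u%:~R / v%:~R :> padic_num p.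
Proof.
move=> v0 ruv; apply/eqP; rewrite /ratr.
rewrite eqr_div ?padic_num_char0 ?denq_neq0 // -!intrM; apply/eqP; congr (_%:~R).
by apply: (@intr_inj rat); rewrite !intrM -ruv numqE; ring.
Qed.

Lemma padic_ratrD (p : prime_nat) (r s : rat) :
  ratr (r + s) = ratr r + ratr s :> padic_num p.
Proof.
have d0 (t : rat) : (denq t)%:~R != 0 :> padic_num p.
  by rewrite padic_num_char0 ?denq_neq0.
rewrite (@padic_ratr_eq _ _ (numq r * denq s + numq s * denq r)
  (denq r * denq s)) ?mulf_neq0 ?denq_neq0 //.
  by rewrite /ratr addf_div // intrD !intrM.
by rewrite mulrDl intrD !intrM !numqE; ring.
Qed.

Lemma padic_ratrM (p : prime_nat) (r s : rat) :
  ratr (r * s) = ratr r * ratr s :> padic_num p.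
Proof.
rewrite (@padic_ratr_eq _ _ (numq r * numq s) (denq r * denq s)).
- by rewrite /ratr mulf_div !intrM.
- by rewrite mulf_neq0 ?denq_neq0.
by rewrite !intrM !numqE; ring.
Qed.

Lemma padic_ratrX (p : prime_nat) (r : rat) (k : nat) :
  ratr (r ^+ k) = ratr r ^+ k :> padic_num p.
Proof.
elim: k => [|k IHk]; first by rewrite !expr0 -[1]/(1%:~R) ratr_int.
by rewrite !exprS padic_ratrM IHk.
Qed.

Lemma ratr_padic_integral (p : prime_nat) (r : rat) :
  coprimez (denq r) (val p)%:Z -> padic_integral (ratr r : padic_num p).
Proof.
move=> /padic_int_coprime_unit[x xd].
have xd' : tofrac x * (denq r)%:~R = 1 :> padic_num p.
  by rewrite -(rmorph_int (@tofrac (padic_int p))) -rmorphM xd rmorph1.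
exists (x * (numq r)%:~R) => //; rewrite rmorphM rmorph_int /ratr mulrC.
have d0 : (denq r)%:~R != 0 :> padic_num p by rewrite padic_num_char0 ?denq_neq0.
by congr (_ * _); apply: (mulIf d0); rewrite mulVf.
Qed.

Lemma ratr_padic_finite (r : rat) :
  finite_set [set p : prime_nat | ~ padic_integral (ratr r : padic_num p)].
Proof.
apply: (@sub_finite_set _ _ (val @^-1` `I_(`|denq r|.+1))).
  move=> p /= npZ; rewrite ltnS leqNgt; apply/negP => dp; apply: npZ; apply: ratr_padic_integral.
  rewrite coprimezE coprime_sym prime_coprime ?(valP p) //.
  by rewrite gtnNdvd // absz_gt0 denq_neq0.
apply: finite_preimage; last exact: finite_II.
by move=> u v _ _; apply: val_inj.
Qed.

End RatPadic.

(* Q_p^3 with the topology "at Z". *)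
Definition padic_space (p : prime_nat) : topologicalType :=
  (indiscrete (padic_num p) * indiscrete (padic_num p) * padic_num p)%type.

(* Places of Q: Some p is the finite place p, None is the place at infinity. *)
Definition place : Type := option prime_nat.

(* Q_v *)
Definition completion (R : realType) (v : place) : fieldType :=
  if v is Some p then padic_num p else R.

(* Z_v, as a subset of Q_v *)
Definition completion_integral (R : realType) (v : place) :
    set (completion R v) :=
  match v with Some p => @padic_integral p | None => setT end.

Definition triple (K : Type) : Type := (K * K * K)%type.

(* Q/Z, the quotient of rat by its subgroup Num.int *)
Definition ratZ : zmodType := Quotient.quot (Num.int_num_subdef : {pred rat}).

Definition rat_mod_int (x : rat) : ratZ :=
  \pi_(Quotient.quot (Num.int_num_subdef : {pred rat})) x.

Lemma rat_mod_int_eq (x y : rat) :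
  (rat_mod_int x = rat_mod_int y) <-> x - y \is a Num.int.
Proof. by rewrite -[_ \is a _]/(_ \in _) Quotient.idealrBE; split=> /eqP. Qed.

Lemma rat_mod_intD (x y : rat) :
  rat_mod_int (x + y) = rat_mod_int x + rat_mod_int y.
Proof. by rewrite /rat_mod_int !piE. Qed.

Section HilbertSymbol.
Variable K : fieldType.

Definition sum_two_squares (u : K) : Prop :=
  exists s t : K, u = s ^+ 2 + t ^+ 2.

(* (u, -1) for u in K^*, where K is Q_v *)
Definition hilbert_m1 (u : K) : int :=
  if `[< sum_two_squares u >] then 1 else -1.

(* invariant of the quaternion algebra (u, -1) over K = Q_v *)
Definition quaternion_inv (u : K) : ratZ :=
  if hilbert_m1 u == 1 then 0 else rat_mod_int 2%:R^-1.

End HilbertSymbol.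

Section Surface.
Variables (n : int) (a b : nat).

Section Points.
Variable K : comNzRingType.

Definition on_surface (P : triple K) : Prop :=
  P.1.1 ^+ 2 + P.1.2 ^+ 2 + P.2 ^+ (a * b) = n%:~R ^+ a.

Definition integral_on_surface (O : set K) (P : triple K) : Prop :=
  on_surface P /\ [/\ O P.1.1, O P.1.2 & O P.2].

Definition surface_g (z : K) : K :=
  \sum_(i < a) n%:~R ^+ (a.-1 - i) * z ^+ (i * b).

Lemma surface_gE (z : K) :
  n%:~R ^+ a - z ^+ (a * b) = (n%:~R - z ^+ b) * surface_g z.
Proof.
rewrite mulnC exprM subrXX; congr (_ * _); apply: eq_bigr => i _.
by rewrite -exprM mulnC.
Qed.

End Points.

(* inv_v A(P) for K = Q_v: the fibre A(P) is the quaternion algebra           *)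
(* (n - z^b, -1) if n <> z^b and (g(z), -1) if g(z) <> 0; surface_invE shows  *)
(* that both descriptions agree where both apply.                             *)
Definition surface_inv (K : fieldType) (P : triple K) : ratZ :=
  if n%:~R - P.2 ^+ b != 0 then quaternion_inv (n%:~R - P.2 ^+ b)
  else quaternion_inv (surface_g P.2).

Lemma sum_two_squares_div (K : fieldType) (u w : K) : u != 0 ->
  sum_two_squares (u * w) -> sum_two_squares u -> sum_two_squares w.
Proof.
move=> u0 [x [y uw]] [s [t us]].
exists ((x * s + y * t) / u), ((x * t - y * s) / u).
have -> : w = (u * w) * u / u ^+ 2 by field.
by rewrite uw [in X in _ * X / _]us; field.
Qed.

Lemma surface_invE (K : fieldType) (P : triple K) : on_surface P ->
  (n%:~R - P.2 ^+ b != 0 ->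
    surface_inv P = quaternion_inv (n%:~R - P.2 ^+ b)) /\
  (surface_g P.2 != 0 -> surface_inv P = quaternion_inv (surface_g P.2)).
Proof.
move=> XP; rewrite /surface_inv; split=> [->//|g0].
case: ifP => // u0; rewrite /quaternion_inv /hilbert_m1.
have ug : sum_two_squares ((n%:~R - P.2 ^+ b) * surface_g P.2).
  by exists P.1.1, P.1.2; rewrite -surface_gE -XP addrK.
rewrite (@asbool_equiv_eq _ (sum_two_squares (surface_g P.2))) //.
by split; apply: sum_two_squares_div => //; rewrite mulrC.
Qed.

(* X(A_{oo}): families of p-adic points, integral for almost all p *)
Record adelic_point := AdelicPoint {
  adelic_coord :> forall p, triple (padic_num p);
  adelic_on_surface : forall p, on_surface (adelic_coord p);
  adelic_integral : finite_set
    [set p | ~ integral_on_surface (@padic_integral p) (adelic_coord p)] }.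

HB.instance Definition _ := gen_eqMixin adelic_point.
HB.instance Definition _ := gen_choiceMixin adelic_point.

(* The restricted product topology is generated by the boxes prod_p U_p with  *)
(* U_p open in X(Q_p) for p in a finite set S and U_p = X(Z_p) for p outside  *)
(* S. These boxes are used as a subbase because X(Z_p) need not be open for   *)
(* the topology "at Z".                                                       *)
Definition adelic_box (S : set prime_nat) (U : forall p, set (padic_space p)) :
    set adelic_point :=
  [set P | forall p,
    (S p -> U p (P p)) /\
    (~ S p -> integral_on_surface (@padic_integral p) (P p))].

Definition adelic_boxes : set (set adelic_point) :=
  [set B | exists S U,
    [/\ finite_set S, forall p, open (U p) & B = adelic_box S U]].

HB.instance Definition _ :=
  isSubBaseTopological.Build adelic_point adelic_boxes id.

Definition diagonal (P : triple rat) (p : prime_nat) : triple (padic_num p) :=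
  (ratr P.1.1, ratr P.1.2, ratr P.2).

Lemma diagonal_on_surface (P : triple rat) :
  on_surface P -> forall p, on_surface (diagonal P p).
Proof.
move=> XP p; rewrite /on_surface /= -!padic_ratrX -!padic_ratrD XP.
by rewrite padic_ratrX ratr_int.
Qed.

Lemma diagonal_integral (P : triple rat) : on_surface P -> finite_set
  [set p | ~ integral_on_surface (@padic_integral p) (diagonal P p)].
Proof.
move=> XP; apply: (@sub_finite_set _ _
  ([set p | ~ padic_integral (ratr P.1.1 : padic_num p)] `|`
   [set p | ~ padic_integral (ratr P.1.2 : padic_num p)] `|`
   [set p | ~ padic_integral (ratr P.2 : padic_num p)])).
  move=> p /= nP; apply: contrapT => /not_orP[/not_orP[/contrapT ? /contrapT ?]].
  move=> /contrapT ?; apply: nP; split=> //; exact: diagonal_on_surface.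
by rewrite !finite_setU; do !split; apply: ratr_padic_finite.
Qed.

Definition rational_point (P : triple rat) (XP : on_surface P) : adelic_point :=
  AdelicPoint (diagonal_on_surface XP) (diagonal_integral XP).

Definition rational_points : set adelic_point :=
  [set P | exists Q (XQ : on_surface Q), P = rational_point XQ].

Definition strong_approximation_at_Z : Prop := dense rational_points.

Section Invariants.
Variable R : realType.

(* X(Z_v) *)
Definition surface_integral_points (v : place) : set (triple (completion R v)) :=
  [set P | integral_on_surface (@completion_integral R v) P].

(* I_v *)
Definition surface_inv_values (v : place) : set ratZ :=
  [set surface_inv P | P in @surface_integral_points v].

Definition add_real_point (P : adelic_point) (Pinf : triple R) (v : place) :
    triple (completion R v) :=
  match v with Some p => P p | None => Pinf end.

(* X(A_{oo})^A. The sum over all places is a sum over its support, which is   *)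
(* finite because the coordinates of P are integral at almost all p.          *)
Definition brauer_manin_set : set adelic_point :=
  [set P | exists Pinf : triple R, on_surface Pinf /\
    \sum_(v \in [set: place]) surface_inv (add_real_point P Pinf v) = 0].

End Invariants.
End Surface.

Arguments surface_integral_points n a b R v : clear implicits.
Arguments surface_inv_values n a b R v : clear implicits.
Arguments brauer_manin_set n a b R : clear implicits.
Arguments rational_points n a b : clear implicits.
Arguments strong_approximation_at_Z n a b : clear implicits.

(* Main.v *)
From HB Require Import structures.
Require Import Defs.
From mathcomp Require Import all_boot all_order all_algebra cyclic finfield.
From mathcomp Require Import finmap all_classical all_reals all_analysis.
From mathcomp Require Import ring zify.

(* At the real place the invariant vanishes identically, so two invariants occur
   at some prime w. At a prime p not dividing 2an the invariant vanishes on
   X(Z_p), since n - z^b or g(z) is then a p-adic unit. Changing the component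
   at w of an integral adelic point if necessary, the sum of the invariants is
   1/2. The invariant is locally constant in z, so a rational point near this adelic
   point "at Z" has the same sum of invariants; but that sum is 0 by the product
   formula for (u, -1)_v with u a positive rational, which follows from the
   explicit description of the sums of two squares in Q_p. *)

Set Implicit Arguments.
Unset Strict Implicit.
Unset Printing Implicit Defensive.

Import Order.TTheory GRing.Theory Num.Theory.

Local Open Scope classical_set_scope.
Local Open Scope ring_scope.

(** * Sums of two squares modulo p and in the integers *)

Lemma dvdz_Fp (p : nat) (m : int) : prime p ->
  (p%:Z %| m)%Z = (m%:~R == 0 :> 'F_p).
Proof. by move=> pp; rewrite (dvdz_pcharf (pchar_Fp pp)). Qed.

Lemma Fp_int_surj (p : nat) (x : 'F_p) : exists m : int, x = m%:~R.
Proof. by exists (x : nat)%:Z; rewrite -pmulrn natr_Zp. Qed.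

(** If [i = - j] in the field, then p divides [i + j <= p - 1], so both are 0. *)
Lemma Fp_sqr_inj (p : nat) (i j : 'I_(p./2).+1) : prime p -> odd p ->
  (i%:R : 'F_p) ^+ 2 = j%:R ^+ 2 -> i = j.
Proof.
move=> pp op /eqP; rewrite eqf_sqr.
have ip := ltn_ord i; have jp := ltn_ord j.
have pE := odd_double_half p; have p1 := prime_gt1 pp.
have modE (k : nat) : (k < p)%N -> ((k%:R : 'F_p) : nat) = k.
  by move=> kp; rewrite val_Fp_nat // modn_small.
case/orP => /eqP ij.
  apply/val_inj; have /(congr1 (@nat_of_ord _)) := ij.
  by rewrite /= !modE //; lia.
have: (i + j)%:R == 0 :> 'F_p by rewrite natrD ij addNr.
rewrite -(dvdn_pcharf (pchar_Fp pp)) => /dvdnP[k ijk]; apply/val_inj => /=.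
by case: k ijk => [|k] ijk; nia.
Qed.

(** Pigeonhole: the (p+1)/2 squares and the (p+1)/2 values [c - j^2] lie in a field with p elements,
    and by [Fp_sqr_inj] a collision must mix the two families. *)
Lemma Fp_sum_two_squares (p : nat) (c : 'F_p) : prime p -> odd p ->
  exists x y : 'F_p, x ^+ 2 + y ^+ 2 = c.
Proof.
move=> pp op.
pose f (u : 'I_(p./2).+1 + 'I_(p./2).+1) : 'F_p :=
  match u with inl i => i%:R ^+ 2 | inr j => c - j%:R ^+ 2 end.
have /injectivePn[u [v uv fuv]] : ~~ injectiveb f.
  apply/negP => /injectiveP /leq_card; rewrite card_sum (card_Fp pp) !card_ord.
  by have := odd_double_half p; lia.
case: u v uv fuv => [i|i] [j|j] uv /=.
- by move/(Fp_sqr_inj pp op) => ij; rewrite ij eqxx in uv.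
- by move=> E; exists i%:R, j%:R; rewrite E subrK.
- by move=> E; exists i%:R, j%:R; rewrite -E addrC subrK.
by move/addrI/oppr_inj/(Fp_sqr_inj pp op) => ij; rewrite ij eqxx in uv.
Qed.

(** The root is the power (p-1)/4 of a generator of the multiplicative group. *)
Lemma Fp_sqrtN1 (p : nat) : prime p -> (p %% 4 = 1)%N ->
  exists i : 'F_p, i ^+ 2 = -1.
Proof.
move=> pp p4; have p1 := prime_gt1 pp.
have cU : #|[set~ (0 : 'F_p)]%SET| = p.-1 by rewrite cardsC1 card_Fp.
have: has p.-1.-primitive_root (enum [set~ (0 : 'F_p)]%SET).
  apply: has_prim_root.
  - by lia.
  - apply/allP => x; rewrite mem_enum !inE => x0; rewrite unity_rootE.
    apply/eqP/(mulIf x0); rewrite mul1r -exprSr prednK 1?ltnW //.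
    by rewrite -[in X in _ ^+ X](card_Fp pp) expf_card.
  - exact: enum_uniq.
  by rewrite -cardE cU.
case/hasP => z _ zP; exists (z ^+ (p.-1 %/ 4)); rewrite -exprM.
have: (z ^+ (p.-1 %/ 4 * 2)) ^+ 2 == 1.
  have -> : (p.-1 %/ 4 * 2)%N = p.-1./2 by lia.
  by rewrite -exprM -(prim_order_dvd zP) (_ : (p.-1./2 * 2)%N = p.-1) //; lia.
rewrite sqrf_eq1 => /orP[|/eqP//].
(* The value 1 at exponent (p-1)/2 would contradict the order p-1 of z. *)
rewrite -(prim_order_dvd zP) => /dvdn_leq H; exfalso.
have {}H : (p.-1 <= p.-1 %/ 4 * 2)%N by apply: H; lia.
lia.
Qed.

(** If y is nonzero, raising [x^2 = - y^2] to the odd power (p-1)/2 gives 1 = -1 by Fermat. *)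
Lemma Fp_sum_two_squares_eq0 (p : nat) (x y : 'F_p) : prime p -> (p %% 4 = 3)%N ->
  x ^+ 2 + y ^+ 2 = 0 -> y = 0.
Proof.
move=> pp p4 /eqP; rewrite addr_eq0 => /eqP xy; apply/eqP/negP => /negP y0.
have p1 := prime_gt1 pp.
have pm1 (z : 'F_p) : z != 0 -> z ^+ p.-1 = 1.
  move=> z0; apply/(mulIf z0); rewrite mul1r -exprSr prednK 1?ltnW //.
  by rewrite -[in X in _ ^+ X](card_Fp pp) expf_card.
have x0 : x != 0 by rewrite -sqrf_eq0 xy oppr_eq0 sqrf_eq0.
have := congr1 (fun z => z ^+ (p.-1)./2) xy.
have E : p.-1 = (2 * p.-1./2)%N by lia.
rewrite exprNn -signr_odd -!exprM -E !pm1 // mulr1.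
have -> : odd p.-1./2 by lia.
move/eqP; rewrite expr1 -subr_eq0 opprK -mulr2n.
rewrite -(dvdn_pcharf (pchar_Fp pp)) => /dvdn_leq -/(_ isT); lia.
Qed.

(** Descent on j: for j > 0, x and y have the same parity, and writing [x = k + l], [y = k - l]
    halves the sum of squares. The case j = 0 is a congruence modulo 4. *)
Lemma sum_two_squares_odd_part (j : nat) (x y q : int) :
  x ^+ 2 + y ^+ 2 <> 2 ^+ j * (4 * q + 3).
Proof.
elim: j x y => [|j IHj] x y E.
  have [k [r [xE r01]]] : exists k r : int, x = 2 * k + r /\ (r = 0 \/ r = 1).
    by exists (x %/ 2)%Z, (x %% 2)%Z; lia.
  have [l [s [yE s01]]] : exists k r : int, y = 2 * k + r /\ (r = 0 \/ r = 1).
    by exists (y %/ 2)%Z, (y %% 2)%Z; lia.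
  have : 4 * (k ^+ 2 + l ^+ 2 + k * r + l * s - q) + (r ^+ 2 + s ^+ 2) = 3.
    by rewrite expr0 mul1r xE yE in E; lia.
  by case: r01 s01 => [->|->] [->|->]; rewrite ?expr0n ?expr1n; lia.
have [k [l [xE yE]]] : exists k l : int, x = k + l /\ y = k - l.
  have : (2 %| x + y)%Z.
    have : (2 %| (x + y) ^+ 2)%Z.
      apply/dvdzP; exists (2 ^+ j * (4 * q + 3) + x * y).
      have -> : (x + y) ^+ 2 = x ^+ 2 + y ^+ 2 + 2 * (x * y) by ring.
      by rewrite E exprS; ring.
    by rewrite !dvdzE abszX Euclid_dvdX // andbT.
  case/dvdzP => k kE; exists k, (x - k); split; lia.
apply: (IHj k l); apply: (@mulfI _ 2) => //.
by rewrite mulrA -exprS -E xE yE; ring.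
Qed.

(** Descent by p^2: if p = 3 mod 4 divides a sum of two squares, it divides both x and y. The
    exponent stays odd until it is 1, and then p would divide m. *)
Lemma sum_two_squares_val (p j : nat) (x y m : int) :
  prime p -> (p %% 4 = 3)%N -> ~~ (p%:Z %| m)%Z -> odd j ->
  x ^+ 2 + y ^+ 2 <> p%:Z ^+ j * m.
Proof.
move=> pp p4 pm oj; rewrite -(odd_double_half j) oj add1n.
have p0 : p%:Z != 0 by have := prime_gt0 pp; lia.
have dvd (u v : int) : (p%:Z %| u ^+ 2 + v ^+ 2)%Z -> (p%:Z %| v)%Z.
  rewrite !dvdz_Fp // rmorphD !rmorphXn /= => /eqP.
  by move=> /(Fp_sum_two_squares_eq0 pp p4) ->.
have descent k (u v : int) : u ^+ 2 + v ^+ 2 = p%:Z ^+ k.+1 * m ->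
    exists i l, u = i * p%:Z /\ v = l * p%:Z.
  move=> E; have uv : (p%:Z %| u ^+ 2 + v ^+ 2)%Z.
    by rewrite E exprS -mulrA dvdz_mulr.
  have /dvdzP[l vE] := dvd _ _ uv; rewrite addrC in uv.
  by have /dvdzP[i uE] := dvd _ _ uv; exists i, l.
elim: (j./2) x y => [|k IHk] x y E; have [i [l [xE yE]]] := descent _ _ _ E.
  case/negP: pm; apply/dvdzP; exists (i ^+ 2 + l ^+ 2).
  by apply: (mulfI p0); rewrite -[in LHS](expr1 p%:Z) -E xE yE; ring.
apply: (IHk i l); apply: (mulfI (expf_neq0 2 p0)).
rewrite mulrA -exprD (_ : (2 + k.*2.+1)%N = k.+1.*2.+1); last by lia.
by rewrite -E xE yE; ring.
Qed.

(** * The p-adic integers *)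

Section PadicIntegers.
Variable p : prime_nat.
Local Notation q := (val p).
Implicit Types x y w : padic_int p.

Lemma padic_res_int (m : int) k :
  padic_res (m%:~R : padic_int p) k = (m %% (q ^ k)%N%:Z)%Z.
Proof. by rewrite -padic_cst_int. Qed.

Lemma padic_res_nat (m : nat) k :
  padic_res (m%:R : padic_int p) k = (m%:Z %% (q ^ k)%N%:Z)%Z.
Proof. by rewrite -padic_res_int pmulrn. Qed.

(** Division by q loses one level of precision, so level k of the quotient is read off level k+1 of
    x. *)
Lemma padic_res1_eq0 x : padic_res x 1 = 0 -> exists y, x = q%:R * y.
Proof.
move=> x1; have q0 : q%:Z != 0 by rewrite eqz_nat -lt0n prime_gt0 ?(valP p).
have dvdx k : (q%:Z %| padic_res x k.+1)%Z.
  apply/dvdz_mod0P; have := padic_res_congrD x 1 k.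
  by rewrite add1n x1 mod0z expn1.
pose h k := (padic_res x k.+1 %/ q)%Z.
have hE k : q%:Z * h k = padic_res x k.+1 by rewrite mulrC divzK.
have hS k : (h k.+1 = h k %[mod (q ^ k)%N%:Z])%Z.
  apply/eqP; rewrite eqz_mod_dvd -(dvdz_mul2l q0) mulrBr !hE.
  by rewrite -PoszM -expnS -eqz_mod_dvd; apply/eqP/padic_res_congr.
exists (padic_mk hS); apply: padic_int_eq => k /=.
by rewrite padic_res_nat modzMml modzMmr hE -padic_resP.
Qed.

Lemma padic_res1_mul x : padic_res (q%:R * x) 1 = 0.
Proof. by rewrite /= padic_res_nat expn1 modzMml modzMr. Qed.

(** Bezout inverses modulo the powers of q are compatible because inverses are unique. *)
Lemma padic_unit_inv x : padic_res x 1 != 0 -> exists y, y * x = 1.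
Proof.
move=> x1; pose h k := (egcdz (padic_res x k) (q ^ k)%N%:Z).1.
have xk k : (padic_res x k.+1 %% q)%Z = padic_res x 1.
  by have := padic_res_congrD x 1 k; rewrite add1n padic_res_mod expn1.
have hP k : (h k * padic_res x k = 1 %[mod (q ^ k)%N%:Z])%Z.
  case: k => [|k]; first by rewrite expn0 !modz1.
  have cop : gcdz (padic_res x k.+1) (q ^ k.+1)%N%:Z = 1.
    apply/eqP; rewrite -[_ == _]/(coprimez _ _) coprimezE absz_nat.
    rewrite coprimeXr // coprime_sym prime_coprime ?(valP p) //.
    by apply: contra x1; rewrite -(xk k) => d; apply/eqP/dvdz_mod0P; rewrite dvdzE.
  rewrite /h; case: egcdzP => u v Euv _ /=.
  by rewrite -cop -Euv addrC modzMDl.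
have hS k : (h k.+1 = h k %[mod (q ^ k)%N%:Z])%Z.
  have h1 : (h k.+1 * padic_res x k = 1 %[mod (q ^ k)%N%:Z])%Z.
    by rewrite -modzMmr -padic_res_congr modzMmr -padic_modS hP padic_modS.
  rewrite -[h k.+1]mulr1 -modzMmr -(hP k) modzMmr mulrCA -modzMmr h1 modzMmr.
  by rewrite mulr1.
exists (padic_mk hS); apply: padic_int_eq => k /=.
by rewrite modzMml hP -padic_res_int.
Qed.

(* [1 + 4 q w = (1 + 2 t)^2] for the fixed point [t] of the contraction
   [t |-> q w - t^2] of [q Z_q]. *)
Lemma padic_hensel_square w : exists s, 1 + 4 * q%:R * w = s ^+ 2.
Proof.
pose h := fix h k : int :=
  if k is l.+1 then q%:Z * padic_res w l.+1 - h l ^+ 2 else 0.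
have hq k : (q%:Z %| h k)%Z.
  elim: k => [|k IHk] /=; first exact: dvdz0.
  by rewrite rpredB ?dvdz_mulr // expr2 dvdz_mulr.
have hS k : (h k.+1 = h k %[mod (q ^ k)%N%:Z])%Z.
  elim: k => [|k IHk]; first by rewrite expn0 !modz1.
  apply/eqP; rewrite eqz_mod_dvd.
  (* The factor [h k.+1 + h k] is divisible by q, which gains one power of q over the induction
     hypothesis. *)
  have -> : h k.+2 - h k.+1 = q%:Z * (padic_res w k.+2 - padic_res w k.+1)
      - (h k.+1 - h k) * (h k.+1 + h k) by rewrite /=; ring.
  rewrite expnS mulnC PoszM rpredB //.
    rewrite mulrC dvdz_mul // -eqz_mod_dvd.
    by apply/eqP; rewrite -padic_modS padic_res_congr padic_modS.
  apply: dvdz_mul; last exact: rpredD.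
  by rewrite -eqz_mod_dvd; apply/eqP.
pose t := padic_mk hS; exists (1 + 2 * t).
have tE : t + t ^+ 2 = q%:R * w.
  apply: padic_int_eq => k.
  have hE : (h k + h k ^+ 2 = q%:Z * padic_res w k %[mod (q ^ k)%N%:Z])%Z.
    by rewrite -modzDml -hS modzDml /= subrK -modzMmr padic_res_congr modzMmr.
  by rewrite /= padic_res_nat !(modzMml, modzMmr) !(modzDml, modzDmr) -expr2.
by rewrite -mulrA -tE; ring.
Qed.

(** Factors q are peeled off until the residue modulo q is nonzero, where [padic_unit_inv] applies.
    This serves both to clear denominators and to find radii of local constancy. *)
Lemma padic_dvd_expn x : x != 0 -> exists k y, x * y = q%:R ^+ k.
Proof.
case/padic_res_neq0 => k /(_ 0%N); rewrite addn0.
elim: k x => [|k IHk] x xk; first by rewrite expn0 dvd1z in xk.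
have [x1|x1] := eqVneq (padic_res x 1) 0; last first.
  by have [y yx] := padic_unit_inv x1; exists 0%N, y; rewrite mulrC yx.
have [y xE] := padic_res1_eq0 x1; have [|l [z yz]] := IHk y.
  apply: contra xk => yk; rewrite xE /=; apply/dvdz_mod0P.
  rewrite modz_mod padic_res_nat modzMml; apply/dvdz_mod0P.
  rewrite expnS PoszM dvdz_mul //.
  by apply/dvdz_mod0P; rewrite padic_res_congr; apply/dvdz_mod0P.
by exists l.+1, z; rewrite xE exprS -mulrA yz.
Qed.

Lemma coprimez_prime (m : int) : ~~ (q%:Z %| m)%Z -> coprimez m q.
Proof.
by rewrite coprimezE coprime_sym prime_coprime ?(valP p) // dvdzE.
Qed.

(** The quotient x/m is 1 modulo q, and 4 is a unit, so x/m has the shape required by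
    [padic_hensel_square]. *)
Lemma padic_square_ratio x (m : int) : odd q -> ~~ (q%:Z %| m)%Z ->
  padic_res (x - m%:~R) 1 = 0 -> exists s, x = s ^+ 2 * m%:~R.
Proof.
move=> oq qm /padic_res1_eq0[w xE].
have [v vm] := padic_int_coprime_unit (coprimez_prime qm).
have [f f4] : exists f : padic_int p, f * 4%:~R = 1.
  apply/padic_int_coprime_unit/coprimez_prime; rewrite dvdzE /=.
  change (~~ (q %| 2 ^ 2)%N); rewrite Euclid_dvdX ?(valP p) // andbT.
  by rewrite dvdn_prime2 ?(valP p) //; apply: contraTN oq => /eqP ->.
have [s sE] := padic_hensel_square (w * v * f); exists s.
rewrite -[LHS](subrK m%:~R) xE -sE.
transitivity (q%:R * w * (f * 4%:~R) * (v * m%:~R) + m%:~R).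
  by rewrite f4 vm !mulr1.
by ring.
Qed.

(** Modulo q, x agrees with an integer [c^2 + d^2], from which it then differs by a square
    factor. *)
Lemma padic_unit_sum_two_squares x : odd q -> padic_res x 1 != 0 ->
  exists s t, x = s ^+ 2 + t ^+ 2.
Proof.
move=> oq x1.
have [a [b ab]] := Fp_sum_two_squares ((padic_res x 1)%:~R : 'F_q) (valP p) oq.
have [c cE] := Fp_int_surj a; have [d dE] := Fp_int_surj b.
have cd : (q%:Z %| c ^+ 2 + d ^+ 2 - padic_res x 1)%Z.
  by rewrite dvdz_Fp ?(valP p) // rmorphB rmorphD !rmorphXn /= -cE -dE ab subrr.
have [||s ->] := @padic_square_ratio x (c ^+ 2 + d ^+ 2) oq.
- apply: contra x1 => qm; have : (q%:Z %| padic_res x 1)%Z.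
    by rewrite -[padic_res x 1](subKr (c ^+ 2 + d ^+ 2)) rpredB.
  by move/dvdz_mod0P => x0; rewrite -padic_res_mod expn1 x0.
- rewrite /= padic_res_int modzNm modzDmr; apply/dvdz_mod0P.
  by rewrite -rpredN opprB expn1.
by exists (s * c%:~R), (s * d%:~R); ring.
Qed.

Lemma padic_sqrtN1 : (q %% 4 = 1)%N -> exists i : padic_int p, i ^+ 2 = -1.
Proof.
move=> q4; have [j jE] := Fp_sqrtN1 (valP p) q4; have [c cE] := Fp_int_surj j.
have cN1 : (q%:Z %| c ^+ 2 + 1)%Z.
  by rewrite dvdz_Fp ?(valP p) // rmorphD rmorphXn /= -cE jE addNr.
have [|||s sE] := @padic_square_ratio (-1) (c ^+ 2).
- by lia.
- apply/negP => qc; have : (q%:Z %| 1%R)%Z.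
    by rewrite -[1](addrK (c ^+ 2)) rpredB // addrC.
  by rewrite dvdzE gtnNdvd // absz_nat prime_gt1 ?(valP p).
- rewrite (_ : _ - _ = (- 1 - c ^+ 2)%:~R); last by rewrite intrB.
  by rewrite padic_res_int; apply/dvdz_mod0P; rewrite -rpredN opprB opprK expn1.
by exists (s * c%:~R); rewrite sE; ring.
Qed.

End PadicIntegers.

(** * Sums of two squares in the p-adic numbers *)

Lemma PoszX (m k : nat) : (m ^ k)%N%:Z = m%:Z ^+ k.
Proof. by rewrite -!natz natrX. Qed.

Lemma fraction_numden (R : idomainType) (x : {fraction R}) :
  exists n d : R, d != 0 /\ x * tofrac d = tofrac n.
Proof.
elim/quotW: x => r; exists (frac r).1, (frac r).2; split.
  exact: denom_ratioP.
unlock tofrac; rewrite -[LHS]FracField.pi_mul; apply/eqmodP.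
rewrite /= FracField.equivfE /FracField.mulf.
rewrite !numden_Ratio ?mulf_neq0 ?oner_neq0 ?denom_ratioP //.
by rewrite !mulr1 mulrC.
Qed.

Section SumTwoSquares.
Variable K : fieldType.
Implicit Types u w : K.

Lemma sum_two_squares_sqr u : sum_two_squares (u ^+ 2).
Proof. by exists u, 0; rewrite expr0n addr0. Qed.

Lemma sum_two_squaresM u w :
  sum_two_squares u -> sum_two_squares w -> sum_two_squares (u * w).
Proof.
move=> [a [b ->]] [c [d ->]]; exists (a * c - b * d), (a * d + b * c); ring.
Qed.

Lemma sum_two_squaresX u k : sum_two_squares u -> sum_two_squares (u ^+ k).
Proof.
move=> u2; elim: k => [|k IHk]; last by rewrite exprS; apply: sum_two_squaresM.
by rewrite expr0 -(expr1n _ 2); apply: sum_two_squares_sqr.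
Qed.

Lemma sum_two_squares_sqrM s u : s != 0 ->
  sum_two_squares (s ^+ 2 * u) <-> sum_two_squares u.
Proof.
move=> s0; split=> [|u2]; last exact/sum_two_squaresM/u2/sum_two_squares_sqr.
move=> su2; apply: (sum_two_squares_div (expf_neq0 2 s0) su2).
exact: sum_two_squares_sqr.
Qed.

(** [u = ((u+1)/2)^2 - ((u-1)/2)^2], and i absorbs the minus sign. *)
Lemma sum_two_squares_sqrtN1 (i u : K) :
  2 != 0 :> K -> i ^+ 2 = -1 -> sum_two_squares u.
Proof.
move=> two0 iN1; exists ((u + 1) / 2), (i * ((u - 1) / 2)).
by rewrite [(i * _) ^+ 2]exprMn iN1; field.
Qed.

Lemma quaternion_inv_eq u w : (sum_two_squares u <-> sum_two_squares w) ->
  quaternion_inv u = quaternion_inv w.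
Proof. by move=> /asbool_equiv_eq uw; rewrite /quaternion_inv /hilbert_m1 uw. Qed.

Lemma quaternion_inv_eq0 u : sum_two_squares u -> quaternion_inv u = 0.
Proof. by move=> /asboolT u2; rewrite /quaternion_inv /hilbert_m1 u2 eqxx. Qed.

Lemma quaternion_invE u (o : bool) : (sum_two_squares u <-> ~~ o) ->
  quaternion_inv u = rat_mod_int 2^-1 *+ o.
Proof.
rewrite /quaternion_inv /hilbert_m1; case: o => uo; last first.
  by rewrite asboolT ?eqxx ?uo.
by rewrite asboolF // => /uo.
Qed.

End SumTwoSquares.

(** Retyping [tofrac] with target [padic_num p] lets it carry ring morphism structures into that
    type. *)
Definition padic_embed (p : prime_nat) : padic_int p -> padic_num p :=
  @tofrac (padic_int p).

HB.instance Definition _ p := GRing.isZmodMorphism.Build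
  (padic_int p) (padic_num p) (@padic_embed p) (@tofrac_is_zmod_morphism _).
HB.instance Definition _ p := GRing.isMonoidMorphism.Build
  (padic_int p) (padic_num p) (@padic_embed p) (@tofrac_is_monoid_morphism _).

Section PadicNumbers.
Variable p : prime_nat.
Local Notation q := (val p).
Local Notation Qp := (padic_num p).

Lemma padic_embed_inj : injective (@padic_embed p).
Proof. by move=> x y /eqP; rewrite tofrac_eq => /eqP. Qed.

Lemma padic_num_nat_neq0 (m : nat) : (0 < m)%N -> m%:R != 0 :> Qp.
Proof. by move=> m0; rewrite pmulrn padic_num_char0 // eqz_nat -lt0n. Qed.

Lemma padic_num_prime_neq0 : q%:R != 0 :> Qp.
Proof. by rewrite padic_num_nat_neq0 // prime_gt0 ?(valP p). Qed.

Lemma padic_num_scale (x : Qp) : exists k z, x * q%:R ^+ k = padic_embed z.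
Proof.
have [n [d [d0 xd]]] := @fraction_numden (padic_int p) x.
have [k [y dy]] := padic_dvd_expn d0; exists k, (n * y).
have -> : (q%:R : Qp) ^+ k = padic_embed (d * y) by rewrite dy rmorphXn rmorph_nat.
by rewrite !rmorphM mulrA; congr (_ * _).
Qed.

Lemma padic_embed_sum_two_squares (z : padic_int p) :
  (exists s t, z = s ^+ 2 + t ^+ 2) -> sum_two_squares (padic_embed z).
Proof.
move=> [s [t ->]]; exists (padic_embed s), (padic_embed t).
by rewrite rmorphD !rmorphXn.
Qed.

(** Clearing denominators and truncating yields integer congruences of any precision, to which the
    descents over the integers apply. *)
Lemma sum_two_squares_approx (u : int) : sum_two_squares (u%:~R : Qp) ->
  exists e, forall N, exists x y : int,
    (q%:Z ^+ N %| x ^+ 2 + y ^+ 2 - q%:Z ^+ (2 * e) * u)%Z.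
Proof.
move=> [s [t ust]].
have [k [x xE]] := padic_num_scale s; have [l [y yE]] := padic_num_scale t.
(* Cross-multiplication gives s and t the common denominator [q ^ (k + l)]. *)
pose X := x * q%:R ^+ l; pose Y := y * q%:R ^+ k.
have E : X ^+ 2 + Y ^+ 2 = q%:R ^+ (2 * (k + l)) * u%:~R.
  apply: padic_embed_inj.
  rewrite /X /Y !(rmorphD, rmorphM, rmorphXn, rmorph_nat, rmorph_int) /=.
  rewrite -xE -yE ust.
  by rewrite mulnC exprM exprD; ring.
exists (k + l)%N => N; exists (padic_res X N), (padic_res Y N).
rewrite -PoszX -eqz_mod_dvd; apply/eqP.
have := congr1 (fun z => padic_res z N) E.
rewrite -natrX pmulrn -intrM padic_res_int /=.
by rewrite modzDm -!expr2 PoszX => ->.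
Qed.

Lemma sum_two_squares_odd (j m : nat) : q = 2%N -> (m %% 4 = 3)%N ->
  ~ sum_two_squares ((q ^ j * m)%:R : Qp).
Proof.
(* Two digits beyond [2 * e + j] fix the cofactor of that power of 2 as m modulo 4. *)
rewrite pmulrn => q2 m3 /sum_two_squares_approx[e] /(_ (2 * e + j + 2)%N)[x [y]].
rewrite q2 => /dvdzP[t xyE].
apply: (@sum_two_squares_odd_part (2 * e + j) x y ((m %/ 4)%N%:Z + t)).
rewrite -[LHS](subrK (2%:Z ^+ (2 * e) * (2 ^ j * m)%N)) xyE.
have mE : m%:Z = 4 * (m %/ 4)%N%:Z + 3 by lia.
by rewrite PoszM PoszX mE !exprD; ring.
Qed.

Lemma sum_two_squares_inert (j m : nat) : (q %% 4 = 3)%N -> ~~ (q %| m)%N ->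
  odd j -> ~ sum_two_squares ((q ^ j * m)%:R : Qp).
Proof.
(* One digit beyond [2 * e + j] fixes the cofactor as m modulo q, hence prime to q. *)
rewrite pmulrn => q3 qm oj /sum_two_squares_approx[e] /(_ (2 * e + j + 1)%N)[x [y]].
move=> /dvdzP[t xyE].
apply: (@sum_two_squares_val q (2 * e + j) x y (m%:Z + t * q%:Z)) => //.
- exact: (valP p).
- apply: contra qm => H; suff : (q%:Z %| m%:Z)%Z by rewrite dvdzE.
  by rewrite -[m%:Z](addrK (t * q%:Z)) rpredB // dvdz_mull.
- by rewrite oddD mul2n odd_double.
rewrite -[LHS](subrK (q%:Z ^+ (2 * e) * (q ^ j * m)%N)) xyE.
by rewrite PoszM PoszX !exprD; ring.
Qed.

Lemma sum_two_squares_split (u : Qp) : (q %% 4 = 1)%N -> sum_two_squares u.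
Proof.
move=> /padic_sqrtN1[i iN1]; apply: (@sum_two_squares_sqrtN1 _ (padic_embed i)).
  exact: padic_num_nat_neq0.
by rewrite -rmorphXn iN1 rmorphN1.
Qed.

Lemma sum_two_squares_unit (m : nat) : odd q -> ~~ (q %| m)%N ->
  sum_two_squares (m%:R : Qp).
Proof.
move=> oq qm; rewrite -(rmorph_nat (@padic_embed p)).
apply/padic_embed_sum_two_squares/padic_unit_sum_two_squares => //.
rewrite padic_res_nat expn1; apply: contra qm => /eqP /dvdz_mod0P.
by rewrite dvdzE.
Qed.

(** By [padic_hensel_square] at 2, every 8k+1 is a square, and 8k+5 = (8k+1) + 2^2. *)
Lemma sum_two_squares_dyadic (m : nat) : q = 2%N -> (m %% 4 = 1)%N ->
  sum_two_squares (m%:R : Qp).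
Proof.
move=> q2 m1.
have sq8 (k : nat) : exists s : padic_int p, (8 * k + 1)%:R = s ^+ 2.
  have [s sE] := @padic_hensel_square p k%:R; exists s; rewrite -sE.
  by rewrite q2 natrD natrM; ring.
rewrite -(rmorph_nat (@padic_embed p)); apply: padic_embed_sum_two_squares.
have [m8|m8] := eqVneq (m %% 8)%N 1%N.
  have [s sE] := sq8 (m %/ 8)%N; exists s, 0; rewrite expr0n addr0 -sE.
  by congr (_%:R); lia.
have [s sE] := sq8 (m %/ 8)%N; exists s, 2; rewrite -sE -natrX -natrD.
by congr (_%:R); lia.
Qed.

End PadicNumbers.

(* The nontrivial values of the Hilbert symbol [(u, -1)_p] for a positive
   integer [u]. *)
Definition m1_obstructed (p u : nat) : bool :=
  if p == 2 then (u`_2^' %% 4 == 3)%N else (p %% 4 == 3)%N && odd (logn p u).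

(** Write u = p^k m with m prime to p. At 2 only m modulo 4 counts, as 2 = 1 + 1. For p = 1 mod 4
    everything is a sum of two squares. For p = 3 mod 4 the unit m is one, so only the parity of k
    counts. *)
Lemma sum_two_squares_natP (p : prime_nat) (u : nat) : (0 < u)%N ->
  sum_two_squares (u%:R : padic_num p) <-> ~~ m1_obstructed (val p) u.
Proof.
move=> u0; have pp := valP p; rewrite /m1_obstructed.
pose k := logn (val p) u; pose m := (u`_(val p)^')%N.
have uE : u = (val p ^ k * m)%N by rewrite -p_part partnC.
have pm : ~~ (val p %| m)%N.
  by rewrite -prime_coprime // -(@coprime_pexpl 1) // coprime_sym
     (@p'nat_coprime (val p)) ?part_pnat // pnat_id.
have [q2|q2] := eqVneq (val p) 2%N.
  have mE : m = (u`_2^')%N by rewrite /m q2.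
  have om : odd m by move: pm; rewrite q2 dvdn2 negbK.
  rewrite -mE; split=> [|m3].
    by rewrite {1}uE => H; apply/negP => /eqP m3; apply: sum_two_squares_odd H.
  rewrite uE natrM; apply: sum_two_squaresM; last first.
    by apply: sum_two_squares_dyadic => //; lia.
  rewrite natrX; apply: sum_two_squaresX; exists 1, 1.
  by rewrite q2 expr1n.
have oq : odd (val p) by case: (even_prime pp) => // /eqP; rewrite (negPf q2).
have [q3|q3] := eqVneq (val p %% 4)%N 3%N; last first.
  by split=> // _; apply: sum_two_squares_split; lia.
rewrite /= -/k; split=> [|ok].
  by rewrite {1}uE => H; apply/negP => ok; apply: sum_two_squares_inert H.
rewrite uE natrM; apply: sum_two_squaresM; last exact: sum_two_squares_unit.
rewrite natrX -(odd_double_half k) (negPf ok) add0n -muln2 exprM.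
exact: sum_two_squares_sqr.
Qed.

(** * The product formula *)

Definition primes_upto (N : nat) : seq prime_nat := pmap insub (iota 0 N.+1).

Lemma primes_upto_uniq N : uniq (primes_upto N).
Proof. exact/pmap_sub_uniq/iota_uniq. Qed.

Lemma mem_primes_upto N (p : prime_nat) : (p \in primes_upto N) = (val p <= N)%N.
Proof. by rewrite mem_pmap_sub mem_iota add0n ltnS. Qed.

Lemma m1_obstructedM (p u v : nat) : (0 < u)%N -> (0 < v)%N ->
  m1_obstructed p (u * v) = m1_obstructed p u (+) m1_obstructed p v.
Proof.
move=> u0 v0; rewrite /m1_obstructed; case: ifP => _; last first.
  by rewrite lognM // oddD; case: (_ == _).
have od (w : nat) : odd (w`_2^')%N.
  by have := part_pnat (2^')%N w; rewrite p'natE // dvdn2 negbK.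
rewrite partnM //; have := od u; have := od v.
by move: (u`_2^')%N (v`_2^')%N; nia.
Qed.

Lemma m1_obstructed1 p : m1_obstructed p 1 = false.
Proof. by rewrite /m1_obstructed partn1 logn1 andbF; case: ifP. Qed.

(** For l = 3 mod 4 the symbol is nontrivial exactly at 2 and at l. The two places appear as
    separate summands so that each can be summed over p on its own. *)
Lemma m1_obstructed_prime (p l : nat) : prime l ->
  m1_obstructed p l =
    ((l %% 4 == 3) && (p == 2) (+) (l %% 4 == 3) && (p == l))%N.
Proof.
move=> lp; rewrite /m1_obstructed logn_prime //.
have [->|p2] := eqVneq p 2%N; last first.
  by have [->|] := eqVneq p l; rewrite ?andbT ?andbF.
have [->|l2] := eqVneq l 2%N; first by rewrite part_p'nat.
have l2' : (2^'.-nat l)%N by rewrite p'natE // dvdn_prime2 // eq_sym.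
by rewrite part_pnat_id // andbT andbF addbF.
Qed.

Lemma big_addb_pred1 (T : eqType) (s : seq T) (x : T) : uniq s ->
  \big[addb/false]_(y <- s) (y == x) = (x \in s).
Proof.
elim: s => [|y s IHs] /=; first by rewrite big_nil.
move=> /andP[ys us]; rewrite big_cons IHs // inE eq_sym.
by have [->|] := eqVneq x y; rewrite ?(negPf ys).
Qed.

(* [(u, -1)_2 = -1] iff an odd number of primes [= 3 mod 4] divide [u] to an
   odd power, as both sides are additive in [u]. *)
Lemma m1_reciprocity (N u : nat) : (0 < u <= N)%N ->
  \big[addb/false]_(p <- primes_upto N) m1_obstructed (val p) u = false.
Proof.
elim/ltn_ind: u => u IHu /andP[u0 uN].
have [->|u1] := eqVneq u 1%N.
  by apply: big1_seq => p _; rewrite m1_obstructed1.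
have lp : prime (pdiv u) by apply: pdiv_prime; lia.
have /dvdnP[v uE] := pdiv_dvd u; have l1 := prime_gt1 lp.
move: (pdiv u) lp uE l1 => l lp uE l1.
have v0 : (0 < v)%N by rewrite lt0n; apply/eqP => vE; rewrite uE vE in u0.
have lu : (l <= u)%N by rewrite uE leq_pmull.
(* The cofactor v is handled by induction, and the contributions of l at 2 and at l cancel. *)
rewrite (eq_bigr (fun p : prime_nat => m1_obstructed (val p) v (+)
    ((l %% 4 == 3) && (val p == 2) (+) (l %% 4 == 3) && (val p == l))%N)); last first.
  by move=> p _; rewrite -m1_obstructed_prime // -m1_obstructedM ?(ltnW l1) // -uE.
have vu : (v < u)%N by rewrite uE ltn_Pmulr.
rewrite big_split /= IHu ?v0 ?(leq_trans (ltnW vu)) //=.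
case: (l %% 4 == 3)%N; last by rewrite big1.
have mem (k : nat) (kp : prime k) : (k <= N)%N ->
    \big[addb/false]_(p <- primes_upto N) (val p == k) = true.
  move=> kN; transitivity ((Sub k kp : prime_nat) \in primes_upto N).
    by rewrite -big_addb_pred1 ?primes_upto_uniq.
  by rewrite mem_primes_upto.
rewrite big_split /= !mem ?(leq_trans lu) //.
by apply: leq_trans uN; lia.
Qed.

Local Notation half := (rat_mod_int 2^-1).

Lemma rat_mod_int_eq0 (x : rat) : (rat_mod_int x = 0) <-> x \is a Num.int.
Proof.
have -> : 0 = rat_mod_int 0.
  by apply: (addrI (rat_mod_int 0)); rewrite addr0 -rat_mod_intD addr0.
by rewrite rat_mod_int_eq subr0.
Qed.

Lemma rat_mod_int_halfD : half + half = 0.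
Proof.
rewrite -rat_mod_intD (_ : 2^-1 + 2^-1 = 1); last by field.
by apply/rat_mod_int_eq0; exact: rpred1.
Qed.

Lemma rat_mod_int_half_neq0 : half <> 0.
Proof.
move=> /rat_mod_int_eq0/intrP[m mE].
have : (2 * m = 1)%R.
  by apply: (@intr_inj rat); rewrite intrM -mE; field.
lia.
Qed.

Lemma rat_mod_int_half_addb (b c : bool) :
  half *+ (b (+) c) = half *+ b + half *+ c.
Proof.
by case: b; case: c; rewrite /= ?mulr0n ?mulr1n ?addr0 ?add0r ?rat_mod_int_halfD.
Qed.

Lemma padic_ratr_neq0 (p : prime_nat) (r : rat) :
  r != 0 -> ratr r != 0 :> padic_num p.
Proof.
move=> r0; rewrite /ratr.
by rewrite mulf_neq0 ?invr_eq0 ?padic_num_char0 ?denq_neq0 ?numq_eq0.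
Qed.

Lemma quaternion_inv_reciprocity (r : rat) : 0 < r ->
  exists N, forall M, (N <= M)%N ->
    \sum_(p <- primes_upto M) quaternion_inv (ratr r : padic_num p) = 0.
Proof.
(* Numerator times denominator differs from r by the square of the denominator, so it has the same
   symbols. *)
move=> r0; pose u := (`|numq r| * `|denq r|)%N; exists u => M uM.
have u0 : (0 < u)%N by rewrite muln_gt0 !absz_gt0 numq_eq0 gt_eqF //= denq_neq0.
have invE (p : prime_nat) :
    quaternion_inv (ratr r : padic_num p) = half *+ m1_obstructed (val p) u.
  apply: quaternion_invE; rewrite -sum_two_squares_natP //.
  have d0 : (denq r)%:~R != 0 :> padic_num p by rewrite padic_num_char0 ?denq_neq0.
  rewrite -(sum_two_squares_sqrM _ d0).
  suff -> : (denq r)%:~R ^+ 2 * ratr r = u%:R :> padic_num p by [].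
  rewrite pmulrn PoszM !gez0_abs ?denq_ge0 ?numq_ge0 ?ltW // intrM /ratr.
  by rewrite expr2 -mulrA [X in _ * X]mulrC divfK // mulrC.
under eq_bigr => p _ do rewrite invE.
have half0 : half *+ false = 0 by rewrite mulr0n.
rewrite -(big_morph _ rat_mod_int_half_addb half0).
by rewrite m1_reciprocity ?u0.
Qed.

(** * Local invariants of the surface *)

Section Surface.
Variables (n : int) (a b : nat).
Hypotheses (n_neq0 : n != 0) (a_gt0 : (0 < a)%N).

(** View g as a polynomial in [T = z ^+ b]: replacing each T^i by n^i costs a multiple of T - n and
    leaves a equal terms n^(a-1). *)
Lemma surface_g_approx (K : comNzRingType) (z : K) : exists s,
  surface_g n a b z = a%:R * n%:~R ^+ a.-1 + (z ^+ b - n%:~R) * s.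
Proof.
exists (\sum_(i < a) n%:~R ^+ (a.-1 - i) *
  \sum_(j < i) (z ^+ b) ^+ (i.-1 - j) * n%:~R ^+ j).
rewrite mulr_sumr mulr_natl -[X in _ *+ X]card_ord -sumr_const -big_split /=.
apply: eq_bigr => i _; have ia : (i <= a.-1)%N by rewrite -ltnS prednK.
rewrite mulrCA -subrXX -exprM [(b * i)%N]mulnC mulrBr -exprD (subnK ia).
by rewrite addrC subrK.
Qed.

Lemma surface_g_root (K : comNzRingType) (z : K) : z ^+ b = n%:~R ->
  surface_g n a b z = (a%:Z * n ^+ a.-1)%:~R.
Proof.
move=> zn; have [s ->] := surface_g_approx z.
by rewrite zn subrr mul0r addr0 intrM rmorphXn pmulrn.
Qed.

Lemma padic_embed_surface_g (p : prime_nat) (z : padic_int p) :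
  surface_g n a b (padic_embed z) = padic_embed (surface_g n a b z).
Proof.
rewrite /surface_g rmorph_sum; apply: eq_bigr => i _.
by rewrite rmorphM !rmorphXn rmorph_int.
Qed.

Lemma padic_embed_surface_u (p : prime_nat) (z : padic_int p) :
  n%:~R - padic_embed z ^+ b = padic_embed (n%:~R - z ^+ b).
Proof. by rewrite rmorphB rmorph_int rmorphXn. Qed.

Lemma padic_embed_unit (p : prime_nat) (z : padic_int p) : odd (val p) ->
  padic_res z 1 != 0 ->
  padic_embed z != 0 /\ quaternion_inv (padic_embed z) = 0.
Proof.
move=> op z1; split.
  rewrite tofrac_eq0; apply: contra z1 => /eqP ->.
  by rewrite -[0](mulr0z 1) padic_res_int mod0z.
apply/quaternion_inv_eq0/padic_embed_sum_two_squares.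
exact: padic_unit_sum_two_squares.
Qed.

(* At such [p] the factors [n - z^b] and [g(z)] cannot both be divisible by
   [p], as [g(z) = a n^(a-1)] modulo [n - z^b]. *)
Lemma surface_inv_good (p : prime_nat) (P : triple (padic_num p)) :
  odd (val p) -> ~~ (val p %| a * `|n|)%N ->
  integral_on_surface n a b (@padic_integral p) P -> surface_inv n a b P = 0.
Proof.
move=> op pan [PX [_ _ [z _ zE]]].
have {}zE : P.2 = padic_embed z by rewrite -zE.
have [uP gP] := surface_invE PX; move: uP gP.
rewrite zE padic_embed_surface_u padic_embed_surface_g => uP gP.
have [u1|u1] := eqVneq (padic_res (n%:~R - z ^+ b) 1) 0; last first.
  by have [u0 <-] := padic_embed_unit op u1; apply: uP.
suff g1 : padic_res (surface_g n a b z) 1 != 0.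
  by have [g0 <-] := padic_embed_unit op g1; apply: gP.
have [w wE] := padic_res1_eq0 u1; have [s ->] := surface_g_approx z.
rewrite -(opprB _ (z ^+ b)) wE mulNr -mulrA pmulrn -rmorphXn -intrM pmulrn.
rewrite /= !padic_res_int expn1 !(modzMml, modzMmr) modzNm modzDm.
apply: contra pan => /eqP/dvdz_mod0P.
move: (padic_res w 1 * padic_res s 1) => r pr.
have {pr} : ((val p)%:Z %| a%:Z * n ^+ a.-1)%Z.
  by rewrite -[X in (_ %| X)%Z](subrK ((val p)%:Z * r)) rpredD // dvdz_mulr.
rewrite dvdzE abszM abszX Euclid_dvdM ?(valP p) //.
case/orP => [pa|]; first by rewrite dvdn_mulr.
by rewrite Euclid_dvdX ?(valP p) // => /andP[pn _]; rewrite dvdn_mull.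
Qed.

(** If 4 q c d = q^k, then c + q^k t = c (1 + 4 q d t), and the second factor is a nonzero
    square. *)
Lemma padic_sum_two_squares_near (p : prime_nat) (c : padic_int p) : c != 0 ->
  exists k, forall t, let c' := c + (val p)%:R ^+ k * t in
    padic_embed c' != 0 /\
    quaternion_inv (padic_embed c') = quaternion_inv (padic_embed c).
Proof.
move=> c0; have c40 : 4 * (val p)%:R * c != 0.
  rewrite !mulf_neq0 // -tofrac_eq0 -[tofrac _]/(padic_embed _) rmorph_nat.
    exact: padic_num_nat_neq0.
  exact: padic_num_prime_neq0.
have [k [d dE]] := padic_dvd_expn c40; exists k => t c'.
have [s sE] := padic_hensel_square (d * t).
have c'E : c' = s ^+ 2 * c by rewrite /c' -dE -sE; ring.
have s0 : padic_embed s != 0.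
  (* A zero s would give 4 q d t = -1, impossible modulo q. *)
  apply/negP; rewrite tofrac_eq0 => /eqP s0.
  have : (val p)%:R * (4 * (d * t)) = (-1)%:~R :> padic_int p.
    by rewrite intrN; apply/eqP; rewrite -addr_eq0 addrC mulrCA mulrA sE s0 expr0n.
  move/(congr1 (fun x => padic_res x 1)).
  rewrite padic_res1_mul padic_res_int expn1 => /esym/dvdz_mod0P.
  by rewrite rpredN dvdzE gtnNdvd // absz_nat prime_gt1 ?(valP p).
rewrite c'E rmorphM rmorphXn /=; split.
  by rewrite mulf_neq0 ?expf_neq0 // tofrac_eq0.
exact/quaternion_inv_eq/sum_two_squares_sqrM.
Qed.

(** The invariant is computed from z alone. It is read off n - z^b if this is nonzero, and otherwise
    off g(z) = a n^(a-1), which is nonzero. Moving z by a multiple of q^k moves either value by a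
    multiple of q^k. *)
Lemma surface_inv_near (p : prime_nat) (P : triple (padic_num p)) :
  integral_on_surface n a b (@padic_integral p) P ->
  exists k, forall Q t, on_surface n a b Q -> padic_integral t ->
    Q.2 = P.2 + (val p)%:R ^+ k * t -> surface_inv n a b Q = surface_inv n a b P.
Proof.
move=> [PX [_ _ [z _ zE]]].
have {}zE : P.2 = padic_embed z by rewrite -zE.
have powE k (t : padic_int p) : exists s,
    (z + (val p)%:R ^+ k * t) ^+ b = z ^+ b + (val p)%:R ^+ k * s.
  eexists; rewrite -[LHS](subrK (z ^+ b)) subrXX addrC -[z + _]addrC addrK.
  by rewrite -mulrA; reflexivity.
have embE k (t : padic_int p) : padic_embed z + (val p)%:R ^+ k * padic_embed t
    = padic_embed (z + (val p)%:R ^+ k * t).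
  by rewrite rmorphD rmorphM rmorphXn rmorph_nat.
have [u0|u0] := eqVneq (n%:~R - z ^+ b) 0; last first.
  have [k kP] := padic_sum_two_squares_near u0; exists k => Q t XQ [t' _ t'E].
  rewrite -t'E zE embE => QE; have [s sE] := powE k t'.
  have := kP (- s); rewrite mulrN -addrA -opprD -sE => -[u'0 uE].
  rewrite (surface_invE XQ).1; last by rewrite QE padic_embed_surface_u.
  rewrite (surface_invE PX).1; last by rewrite zE padic_embed_surface_u tofrac_eq0.
  by rewrite QE zE !padic_embed_surface_u.
have zb : z ^+ b = n%:~R by apply/eqP; rewrite eq_sym -subr_eq0 u0.
have g0 : surface_g n a b z != 0.
  rewrite surface_g_root // -tofrac_eq0 -[tofrac _]/(padic_embed _) rmorph_int.
  by rewrite padic_num_char0 // mulf_neq0 ?expf_neq0 // eqz_nat -lt0n.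
have [k kP] := padic_sum_two_squares_near g0; exists k => Q t XQ [t' _ t'E].
rewrite -t'E zE embE => QE; have [s sE] := powE k t'.
(* As z^b = n, the correction term given here for g is a multiple of q^k. *)
have [r rE] := surface_g_approx (z + (val p)%:R ^+ k * t').
have gE : surface_g n a b (z + (val p)%:R ^+ k * t')
    = surface_g n a b z + (val p)%:R ^+ k * (s * r).
  by rewrite rE sE zb surface_g_root // intrM rmorphXn pmulrn; ring.
have [g'0 g'E] := kP (s * r); rewrite -gE in g'0 g'E.
rewrite (surface_invE XQ).2; last by rewrite QE padic_embed_surface_g.
rewrite (surface_invE PX).2; last by rewrite zE padic_embed_surface_g tofrac_eq0.
by rewrite QE zE !padic_embed_surface_g.
Qed.

End Surface.

(** * Choosing and summing invariants in {0, 1/2} *)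

Lemma card_eq_I2 (T : Type) (A : set T) :
  (A #= `I_2)%card -> exists x y, [/\ A x, A y & x <> y].
Proof.
move=> /pcard_eqP/unsquash f.
have [x Ax fx] := @surj _ _ _ _ f 0%N isT.
have [y Ay fy] := @surj _ _ _ _ f 1%N isT.
by exists x, y; split=> // xy; rewrite xy fy in fx.
Qed.

Lemma dependent_choice_ex (I : Type) (T : I -> Type) (Q : forall i, T i -> Prop) :
  (forall i, exists x, Q i x) -> exists f : forall i, T i, forall i, Q i (f i).
Proof.
move=> QP; exists (fun i => projT1 (cid (QP i))) => i.
exact: projT2 (cid (QP i)).
Qed.

Lemma sum_primes_upto (V : nmodType) (F : prime_nat -> V) (N M : nat) : (N <= M)%N ->
  (forall p : prime_nat, (N < val p)%N -> F p = 0) ->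
  \sum_(p <- primes_upto M) F p = \sum_(p <- primes_upto N) F p.
Proof.
move=> NM F0; rewrite [LHS]fsbig_seq ?primes_upto_uniq //.
rewrite [RHS]fsbig_seq ?primes_upto_uniq //; apply/esym/fsbig_widen.
  by move=> p /=; rewrite !mem_primes_upto => /leq_trans; apply.
by move=> p /= [_ /negP]; rewrite mem_primes_upto -ltnNge; apply: F0.
Qed.

Lemma quaternion_inv_cases (K : fieldType) (u : K) :
  quaternion_inv u = 0 \/ quaternion_inv u = half.
Proof. by rewrite /quaternion_inv; case: ifP; [left | right]. Qed.

Lemma half_casesD (x y : ratZ) : x = 0 \/ x = half -> y = 0 \/ y = half ->
  x + y = 0 \/ x + y = half.
Proof.
by case=> [->|->] [->|->]; rewrite ?add0r ?addr0 ?rat_mod_int_halfD; auto.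
Qed.

Lemma half_cases_eq (x y z : ratZ) : x = 0 \/ x = half -> y = 0 \/ y = half ->
  z = 0 \/ z = half -> x <> y -> x <> z -> y = z.
Proof. by case=> -> [] -> [] ->. Qed.

Lemma half_cases_sum (I : Type) (s : seq I) (Q : pred I) (F : I -> ratZ) :
  (forall i, F i = 0 \/ F i = half) ->
  \sum_(i <- s | Q i) F i = 0 \/ \sum_(i <- s | Q i) F i = half.
Proof.
by move=> F01; elim/big_ind: _ => //; [left | exact: half_casesD].
Qed.

(** The sum of F away from j is its own opposite, so it cancels against the copy placed at j. *)
Lemma half_sum_adjust (I : eqType) (s : seq I) (j : I) (F G : I -> ratZ) :
    uniq s -> j \in s -> (forall i, F i = 0 \/ F i = half) ->
    (forall i, G i = if i == j then half + \sum_(i <- s | i != j) F i else F i) ->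
  \sum_(i <- s) G i = half.
Proof.
move=> us js F01 GE; rewrite (bigD1_seq j) //= GE eqxx.
rewrite [X in _ + X](eq_bigr F) => [|i /negPf ij]; last by rewrite GE ij.
rewrite -addrA; case: (half_cases_sum s (fun i => i != j) F01) => ->.
  by rewrite !addr0.
by rewrite rat_mod_int_halfD addr0.
Qed.

(** * Open boxes, the real place and reciprocity for rational points *)

Section Adelic.
Variables (n : int) (a b : nat).

Lemma surface_inv_cases (K : fieldType) (P : triple K) :
  surface_inv n a b P = 0 \/ surface_inv n a b P = half.
Proof. by rewrite /surface_inv; case: ifP => _; apply: quaternion_inv_cases. Qed.

Lemma adelic_box_open (S : set prime_nat) (U : forall p, set (padic_space p)) :
  finite_set S -> (forall p, open (U p)) -> open (@adelic_box n a b S U).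
Proof.
(* Open sets are unions of finite intersections of boxes, here with a single box at both stages. *)
move=> fS oU; exists [set adelic_box S U]; last by rewrite bigcup_set1.
move=> _ ->; exists [fset adelic_box S U]%fset.
  by move=> B /fset1P ->; rewrite inE; exists S, U.
by rewrite set_fset1 bigcap_set1.
Qed.

Lemma padic_ball_open (p : prime_nat) (x : padic_num p) (k : nat) :
  open [set y : padic_num p |
    exists2 t, padic_integral t & y = x + (val p)%:R ^+ k * t].
Proof.
move=> _ [t [t' _ <-] ->]; exists k => _ [s _ <-].
exists (padic_embed (t' + s)); first by exists (t' + s).
rewrite rmorphD mulrDr addrA; congr (_ + _).
Qed.

Hypotheses (n_neq0 : n != 0) (a_gt0 : (0 < a)%N).
Hypothesis n_gt0_or_odd : 0 < n \/ odd (a * b).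

(** Since x^2 + y^2 >= 0, (z^b)^a <= n^a. The a-th root of this is taken by monotonicity, with a odd
    when n < 0. The field is general because both [rat] and the reals are needed. *)
Lemma surface_real_le (K : realFieldType) (P : triple K) :
  on_surface n a b P -> P.2 ^+ b <= n%:~R.
Proof.
rewrite /on_surface mulnC exprM => PX.
have : (P.2 ^+ b) ^+ a <= n%:~R ^+ a by rewrite -PX lerDr addr_ge0 ?sqr_ge0.
move: (P.2 ^+ b) => t ta; rewrite leNgt; apply/negP => nt.
have pos (x y : K) : 0 <= x -> x < y -> ~ y ^+ a <= x ^+ a.
  by move=> x0 xy; rewrite leNgt ltrXn2r ?x0 // -lt0n a_gt0.
have [n0|n0] := lerP 0 (n%:~R : K); first exact: pos n0 nt ta.
case: n_gt0_or_odd => [n_gt0|]; first by rewrite ltNge ler0z ltW in n0.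
rewrite oddM => /andP[oa _].
have [t0|t0] := lerP 0 t.
  by have := le_trans (exprn_ge0 a t0) ta; rewrite exprn_odd_ge0 // leNgt n0.
apply: (pos (- t) (- n%:~R)); rewrite ?oppr_ge0 ?ltrN2 ?(ltW t0) //.
by rewrite (exprNn t) (exprNn n%:~R) -signr_odd oa expr1 !mulN1r lerN2.
Qed.

(** This is the value of g where z^b = n; for n < 0, a is odd and the exponent a-1 is even. *)
Lemma surface_root_pos : 0 < a%:Z * n ^+ a.-1.
Proof.
rewrite mulr_gt0 ?ltz_nat //; case: n_gt0_or_odd => [n0|]; first exact: exprn_gt0.
rewrite oddM => /andP[oa _]; rewrite lt_def expf_neq0 //= exprn_even_ge0 //.
by rewrite -(negbK (odd _)) -oddS prednK // oa.
Qed.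

Lemma surface_inv_real (R : realType) (P : triple R) :
  on_surface n a b P -> surface_inv n a b P = 0.
Proof.
move=> PX; rewrite /surface_inv.
have sq (x : R) : 0 <= x -> quaternion_inv x = 0.
  move=> x0; apply: quaternion_inv_eq0.
  by rewrite -(sqr_sqrtr x0); apply: sum_two_squares_sqr.
case: eqVneq => [/eqP|_] /=; last by rewrite sq // subr_ge0 surface_real_le.
rewrite subr_eq0 eq_sym => /eqP /surface_g_root -> //.
by rewrite sq // ler0z ltW // surface_root_pos.
Qed.

(** One r serves all primes: n - z^b, or a n^(a-1) where that vanishes. Positivity of r makes the
    real symbol trivial, so the product formula runs over primes only. *)
Lemma surface_inv_diagonal (Q : triple rat) : on_surface n a b Q ->
  exists2 r : rat, 0 < r & forall p,
    surface_inv n a b (Defs.diagonal Q p)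
      = quaternion_inv (ratr r : padic_num p).
Proof.
move=> QX; rewrite /surface_inv /=.
have uE p : n%:~R - (ratr Q.2 : padic_num p) ^+ b = ratr (n%:~R - Q.2 ^+ b).
  apply/eqP; rewrite subr_eq -padic_ratrX -padic_ratrD subrK.
  by rewrite ratr_int.
have [u0|u0] := eqVneq (n%:~R - Q.2 ^+ b) 0; last first.
  exists (n%:~R - Q.2 ^+ b).
    by rewrite lt_def u0 subr_ge0 surface_real_le.
  by move=> p; rewrite uE padic_ratr_neq0.
exists (a%:Z * n ^+ a.-1)%:~R; first by rewrite ltr0z surface_root_pos.
move=> p; have /eqP : n%:~R - (ratr Q.2 : padic_num p) ^+ b = 0.
  by rewrite uE u0 -[0](mulr0z 1) ratr_int.
move=> up; rewrite up /= ratr_int surface_g_root //.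
by apply/eqP; rewrite eq_sym -subr_eq0.
Qed.

Lemma diagonal_reciprocity (Q : triple rat) : on_surface n a b Q ->
  exists N, forall M, (N <= M)%N ->
    \sum_(p <- primes_upto M) surface_inv n a b (Defs.diagonal Q p) = 0.
Proof.
move=> /surface_inv_diagonal[r r0 rE].
have [N NP] := quaternion_inv_reciprocity r0; exists N => M NM.
by rewrite -[RHS](NP M NM); apply: eq_bigr => p _; apply: rE.
Qed.

Lemma brauer_manin_sum (R : realType) (P : adelic_point n a b) (Pinf : triple R)
    (N : nat) : on_surface n a b Pinf ->
    (forall p : prime_nat, (N < val p)%N -> surface_inv n a b (P p) = 0) ->
  \sum_(v \in [set: place]) surface_inv n a b (add_real_point P Pinf v) =
  \sum_(p <- primes_upto N) surface_inv n a b (P p).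
Proof.
move=> PX P0; rewrite -(fsbig_widen [set` map Some (primes_upto N)]) //.
  by rewrite -fsbig_seq ?big_map // map_inj_uniq ?primes_upto_uniq // => x y [].
case=> [p|] /= [_ /negP pN]; last exact: surface_inv_real.
by apply: P0; rewrite ltnNge -mem_primes_upto -(mem_map (@Some_inj _)).
Qed.

End Adelic.

(** * A neighbourhood free of rational points *)

Section Obstruction.
Variables (n : int) (a b : nat).
Hypotheses (n_neq0 : n != 0) (a_gt0 : (0 < a)%N).
Hypothesis n_gt0_or_odd : 0 < n \/ odd (a * b).

(** Primes above this bound are odd and do not divide a n. *)
Definition good_bound : nat := (2 + a * `|n|)%N.

Lemma surface_inv_beyond (p : prime_nat) (P : triple (padic_num p)) :
  (good_bound < val p)%N -> integral_on_surface n a b (@padic_integral p) P ->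
  surface_inv n a b P = 0.
Proof.
rewrite /good_bound => pN; apply: surface_inv_good => //.
  by case: (even_prime (valP p)) => // p2; rewrite p2 in pN.
by rewrite gtnNdvd ?muln_gt0 ?a_gt0 ?absz_gt0 // (leq_trans _ pN) // ltnS leq_addl.
Qed.

(** The box fixes the invariants at primes up to N by local constancy, and makes them vanish beyond
    N by integrality. A rational point inside would thus inherit the nonzero sum of P, against
    reciprocity. *)
Lemma obstructed_neighbourhood (P : adelic_point n a b) (N : nat) :
  (forall p, integral_on_surface n a b (@padic_integral p) (P p)) ->
  (good_bound <= N)%N ->
  \sum_(p <- primes_upto N) surface_inv n a b (P p) <> 0 ->
  exists B : set (adelic_point n a b),
    [/\ open B, B P & rational_points n a b `&` B = set0].
Proof.
move=> PZ gN Psum.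
have [k kP] := choice (fun p => surface_inv_near n_neq0 a_gt0 (PZ p)).
pose V p : set (padic_num p) :=
  [set y | exists2 t, padic_integral t & y = (P p).2 + (val p)%:R ^+ k p * t].
(* Only z is constrained, as openness for the topology at Z requires. *)
pose U p : set (padic_space p) := snd @^-1` V p.
exists (@adelic_box n a b [set` primes_upto N] U); split.
- apply: adelic_box_open => [|p]; first exact: finite_seq.
  apply: open_comp; last exact: padic_ball_open.
  by move=> x _; apply: cvg_snd.
- move=> p; split=> // _; exists 0; first by exists 0 => //; rewrite rmorph0.
  by rewrite mulr0 addr0.
rewrite -subset0 => _ [[Q [QX ->]] QB]; apply: Psum.
have [M MP] := diagonal_reciprocity n_neq0 a_gt0 n_gt0_or_odd QX.
(* Reciprocity needs a bound depending on the rational point; the primes beyond N that it brings in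
   contribute 0. *)
rewrite -[RHS](MP (maxn N M) (leq_maxr _ _)) (sum_primes_upto (leq_maxl N M)).
  apply: eq_big_seq => p pN; have [t tZ QE] := (QB p).1 pN.
  by apply/esym/(kP p _ t) => //; exact: diagonal_on_surface.
move=> p pN; apply: surface_inv_beyond; first exact: leq_ltn_trans pN.
by have [_] := QB p; apply; apply/negP; rewrite mem_primes_upto -ltnNge.
Qed.

End Obstruction.

(** * Construction of the obstructed adelic point *)

Theorem theorem4p2 (R : realType) (n : int) (a b : nat)
    (n_neq0 : n != 0) (a_gt0 : (0 < a)%N) (b_gt0 : (0 < b)%N)
    (n_gt0_or_odd : 0 < n \/ odd (a * b))
    (locally_solvable : forall v : place,
      surface_integral_points n a b R v !=set0)
    (two_invariants : exists w : place,
      (surface_inv_values n a b R w #= `I_2)%card) :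
  ~ strong_approximation_at_Z n a b /\
  exists P : adelic_point n a b,
    ~ brauer_manin_set n a b R P /\ ~ closure (rational_points n a b) P.
Proof.
(* The place with two invariants is not the real one, so both 0 and 1/2 are attained at a prime. *)
have [w wP] : exists w : prime_nat, forall x : ratZ, x = 0 \/ x = half ->
    exists2 P, integral_on_surface n a b (@padic_integral w) P
      & surface_inv n a b P = x.
  case: two_invariants => v /card_eq_I2[_ [_ [[P PZ <-] [Q QZ <-] PQ]]].
  case: v P PZ Q QZ PQ => [w|] P PZ Q QZ PQ; last first.
    by case: PQ; rewrite !surface_inv_real //; [case: QZ | case: PZ].
  exists w => x xh; have [Px|Px] := pselect (surface_inv n a b P = x).
    by exists P.
  exists Q; first exact: QZ.
  apply: (half_cases_eq _ _ xh PQ Px); exact: surface_inv_cases.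
have [P0 P0Z] :=
  dependent_choice_ex (fun p : prime_nat => locally_solvable (Some p)).
pose N := maxn (good_bound n a) (val w).
pose inv0 p := surface_inv n a b (P0 p : triple (padic_num p)).
pose rest := \sum_(p <- primes_upto N | p != w) inv0 p.
have rest01 : rest = 0 \/ rest = half.
  by apply: half_cases_sum => p; apply: surface_inv_cases.
(* The value [half + rest] at w turns the total into 1/2, as [rest + rest = 0]. *)
have [Pw PwZ Pw_inv] := wP _ (half_casesD (or_intror erefl) rest01).
have /dependent_choice_ex[P' P'P] (p : prime_nat) :
  exists Q : triple (padic_num p),
    integral_on_surface n a b (@padic_integral p) Q /\
    surface_inv n a b Q = if p == w then half + rest else inv0 p.
  have [->|pw] := eqVneq p w; first by exists Pw.
  by exists (P0 p); split; first exact: P0Z.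
have P'Z p := (P'P p).1; have P'inv p := (P'P p).2.
have P'fin : finite_set
    [set p | ~ integral_on_surface n a b (@padic_integral p) (P' p)].
  by apply: (@sub_finite_set _ _ set0) => // p /(_ (P'Z p)).
pose P := AdelicPoint (fun p => (P'Z p).1) P'fin.
have Psum : \sum_(p <- primes_upto N) surface_inv n a b (P p) = half.
  apply: (half_sum_adjust (primes_upto_uniq N) _ _ P'inv).
    by rewrite mem_primes_upto leq_maxr.
  by move=> p; apply: surface_inv_cases.
have [||B [oB BP QB]] :=
  @obstructed_neighbourhood n a b n_neq0 a_gt0 n_gt0_or_odd P N P'Z.
- exact: leq_maxl.
- by rewrite Psum; exact: rat_mod_int_half_neq0.
split.
  by move=> /(_ B) []; [exists P | exact: oB | rewrite setIC QB => x].
exists P; split.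
  (* Whatever the real point, it contributes 0, so the full sum is still 1/2. *)
  move=> [Pinf [PinfX]]; rewrite (@brauer_manin_sum n a b _ _ _ _ _ _ N) //.
    by rewrite Psum; exact: rat_mod_int_half_neq0.
  move=> p pN; apply: surface_inv_beyond => //.
  exact: leq_ltn_trans (leq_maxl _ _) pN.
move=> /(_ B); rewrite QB => -[|x []].
exact: open_nbhs_nbhs.
Qed.
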